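(* Let $V_a$, $\{V_{a_i}\}_{i\in\mathbb{N}}$, $\{R_i\}_{i\in\mathbb{N}}$ be a space splitting as in the context: $\mathrm{span}(\{R_iV_{a_i}\}_{i\in\mathbb{N}})$ is dense in $V_a$, and for some constant $\Lambda$ one has $\|R_iv_i\|_a\le \Lambda\|v_i\|_{a_i}$ for all $v_i\in V_{a_i}$, $i\in\mathbb{N}$. Let $u\in V_a$ be the solution of the variational problem $a(u,v)=F(v)$ for all $v\in V$. Let $\pi=\{\pi_i\}_{i\in\mathbb{N}}$ be a discrete probability distribution with $\pi_i>0$ for all $i\in\mathbb{N}$, and let $\pi^{(m)}=\{\pi^{(m)}_i\}_{i\in\mathbb{N}}$, $m\ge0$, be discrete probability distributions such that, for some constant $D>0$, $$\|\pi^{(m)}-\pi\|_{\ell^1}\le D(m+2)^{-1/2},\qquad m\ge 0.$$ Let $u^{(m)}$, $m\ge 0$, be the iterates of the Schwarz iterative method described in the context, with $u^{(0)}=0$, $\alpha_m=1-(m+2)^{-1}$, $\omega_m$ given by exact error minimization, and with indices $i_m\in\mathbb{N}$ chosen randomly and independently, $i_m$ according to $\pi^{(m)}$, $m\ge 0$. Then for any $h\in\mathcal{A}^\pi_\infty$ there is a constant $C$ depending only on $\Lambda$, $\|u\|_a$, $\|h\|_{\mathcal{A}^\pi_\infty}$ and $D$ such that $$E(\|u-u^{(m)}\|_a^2)^{1/2}\le 2\|u-h\|_a+C(m+1)^{-1/2},\qquad m\ge 0.$$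
   Context: **Setting.** $V$ is a separable real or complex Hilbert space, $a(\cdot,\cdot)$ is a continuous coercive Hermitian form on $V$, and $V_a$ denotes $V$ equipped with the (equivalent) scalar product $a$ and norm $\|v\|_a=a(v,v)^{1/2}$. Hermitian forms are linear in the first argument. $F$ is a bounded linear functional on $V$ (conjugate-linear in the complex case), so that the problem ''find $u\in V$ with $a(u,v)=F(v)$ for all $v\in V$'' has a unique solution. For each $i\in\mathbb{N}$, $V_{a_i}$ is a Hilbert space with scalar product $a_i(\cdot,\cdot)$ and norm $\|\cdot\|_{a_i}$, and $R_i:V_{a_i}\to V_a$ is a bounded linear operator. No stability of the splitting is assumed. **Operators $T_i$.** $T_i:V_a\to V_{a_i}$ is defined by $a_i(T_iv,v_i)=a(v,R_iv_i)$ for all $v_i\in V_{a_i}$. **Schwarz iterative method.** Given $u^{(m)}$, an index $i=i_m\in\mathbb{N}$ is picked (by the rule specified in the claim), one computes $r_i^{(m)}=T_i(u-u^{(m)})$ and sets $$u^{(m+1)}=\alpha_mu^{(m)}+\omega_mR_ir_i^{(m)},\qquad \alpha_m=1-(m+2)^{-1},\qquad \omega_m=\frac{a(u-\alpha_mu^{(m)},R_ir_i^{(m)})}{\|R_ir_i^{(m)}\|_a^2},$$ i.e. $\omega_m$ is the minimizer of $\omega\mapsto\|u-\alpha_mu^{(m)}-\omega R_ir_i^{(m)}\|_a$ over scalars $\omega$. If $R_ir_i^{(m)}=0$, the value of $\omega_m$ is irrelevant and $u^{(m+1)}=\alpha_mu^{(m)}$. **Approximation space.** A discrete probability distribution is a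 sequence $\pi=\{\pi_i\}_{i\in\mathbb{N}}$ with $\pi_i\ge0$, $\sum_i\pi_i=1$. For $\pi$ with all $\pi_i>0$, define for $u\in\mathrm{span}(\{R_iV_{a_i}\}_{i\in\mathbb{N}})$ $$\|u\|_{\mathcal{A}^\pi_\infty}=\inf\left\{\max_{i\in I}\pi_i^{-1}\|v_i\|_{a_i}:\ u=\sum_{i\in I}R_iv_i,\ v_i\in V_{a_i},\ I\subset\mathbb{N}\text{ finite}\right\},$$ and let $\mathcal{A}^\pi_\infty$ be the completion with respect to this norm. One has $\|\cdot\|_a\le\Lambda\|\cdot\|_{\mathcal{A}^\pi_\infty}$ on the span, and elements of the completion are regarded as elements of $V_a$ via the continuous extension of the inclusion of the span into $V_a$. *)

(* Defs.v *)
From HB Require Import structures.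
From mathcomp Require Import all_boot all_order all_algebra.
From mathcomp Require Import finmap.
From mathcomp Require Import all_classical all_reals all_analysis.
From mathcomp Require Import complex.

Set Implicit Arguments.
Unset Strict Implicit.
Unset Printing Implicit Defensive.

Import Order.TTheory GRing.Theory Num.Theory.
Import numFieldNormedType.Exports.

Local Open Scope classical_set_scope.
Local Open Scope ring_scope.

Inductive scalar_kind := RealScalars | ComplexScalars.

Definition scalarK (R : realType) (k : scalar_kind) : numFieldType :=
  match k with
  | RealScalars => R
  | ComplexScalars => R[i]%C
  end.

Definition sconj {R : realType} {k : scalar_kind} :
    scalarK R k -> scalarK R k :=
  match k with
  | RealScalars => fun x => x
  | ComplexScalars => fun x : R[i]%C => conjc x
  end.

Definition sre {R : realType} {k : scalar_kind} : scalarK R k -> R :=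
  match k with
  | RealScalars => fun x => x
  | ComplexScalars => fun x : R[i]%C => complex.Re x
  end.

Definition sreal {R : realType} {k : scalar_kind} : R -> scalarK R k :=
  match k with
  | RealScalars => fun x => x
  | ComplexScalars => fun x => (x%:C)%C
  end.

(* The library norm takes its values in the scalar field itself; [rnorm] is
   the same number seen in [R]. It also applies to scalars (modulus). *)
Definition rnorm {R : realType} {k : scalar_kind}
    {V : normedZmodType (scalarK R k)} (v : V) : R := sre `|v|.

Definition form_norm {R : realType} {k : scalar_kind}
    {V : lmodType (scalarK R k)} (a : V -> V -> scalarK R k) (v : V) : R :=
  Num.sqrt (sre (a v v)).

(* A Hilbert space is a complete normed space whose norm comes from [s]. *)
Definition induces_norm {R : realType} {k : scalar_kind}
    {V : completeNormedModType (scalarK R k)} (s : {dot V for sconj}) : Prop :=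
  forall v : V, `|v| ^+ 2 = s v v.

Definition separable_space (T : topologicalType) : Prop :=
  exists2 S : set T, countable S & dense S.

Definition continuous_form {R : realType} {k : scalar_kind}
    {V : normedModType (scalarK R k)} (a : V -> V -> scalarK R k) : Prop :=
  exists M : R, forall v w : V, rnorm (a v w) <= M * rnorm v * rnorm w.

Definition coercive_form {R : realType} {k : scalar_kind}
    {V : normedModType (scalarK R k)} (a : V -> V -> scalarK R k) : Prop :=
  exists2 c : R, 0 < c & forall v : V, c * rnorm v ^+ 2 <= sre (a v v).

Definition conj_linear {R : realType} {k : scalar_kind}
    {V : lmodType (scalarK R k)} (F : V -> scalarK R k) : Prop :=
  forall (c : scalarK R k) (v w : V), F (c *: v + w) = sconj c * F v + F w.

Definition bounded_functional {R : realType} {k : scalar_kind}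
    {V : normedModType (scalarK R k)} (F : V -> scalarK R k) : Prop :=
  exists M : R, forall v : V, rnorm (F v) <= M * rnorm v.

Definition splitting_span {R : realType} {k : scalar_kind}
    {V : lmodType (scalarK R k)} {W : nat -> lmodType (scalarK R k)}
    (Rop : forall i, {linear W i -> V}) : set V :=
  [set x | exists (I : {fset nat}) (v : forall i, W i),
      x = \sum_(i <- I) Rop i (v i)].

Definition form_dense {R : realType} {k : scalar_kind}
    {V : lmodType (scalarK R k)} (a : V -> V -> scalarK R k) (S : set V) : Prop :=
  forall (v : V) (e : R), 0 < e -> exists2 w, S w & form_norm a (v - w) < e.

(* Weights [pi i > 0] make the terms nonnegative, so starting the maximum at
   [0] only matters for the empty decomposition of the zero vector. *)
Definition approx_norm {R : realType} {k : scalar_kind}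
    {V : lmodType (scalarK R k)} {W : nat -> lmodType (scalarK R k)}
    (aW : forall i, W i -> W i -> scalarK R k)
    (Rop : forall i, {linear W i -> V}) (pi : nat -> R) (x : V) : R :=
  inf [set r | exists (I : {fset nat}) (v : forall i, W i),
      x = \sum_(i <- I) Rop i (v i) /\
      r = \big[Num.max/0]_(i <- I) ((pi i)^-1 * form_norm (aW i) (v i))].

(* [A], with [j] defined on the subspace [S] of [V], is the completion of [S]
   for the norm [N]. Values of [j] outside [S] are irrelevant. *)
Definition is_completion {R : realType} {k : scalar_kind}
    {V : lmodType (scalarK R k)} (S : set V) (N : V -> R)
    (A : completeNormedModType (scalarK R k)) (j : V -> A) : Prop :=
  [/\ forall (c : scalarK R k) (x y : V), S x -> S y ->
        j (c *: x + y) = c *: j x + j y,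
      forall x : V, S x -> rnorm (j x) = N x
    & dense (j @` S)].

(* [iota] is the continuous extension to [A] of the inclusion of [S] in [V];
   it need not be injective. *)
Definition extends_inclusion {R : realType} {k : scalar_kind}
    {V : normedModType (scalarK R k)} (S : set V)
    (A : completeNormedModType (scalarK R k)) (j : V -> A)
    (iota : A -> V) : Prop :=
  continuous iota /\ forall x : V, S x -> iota (j x) = x.

Definition discrete_distribution {R : realType} (p : nat -> R) : Prop :=
  (forall i, 0 <= p i) /\ (\sum_(0 <= i <oo) (p i)%:E = 1)%E.

Definition l1_norm {R : realType} (p : nat -> R) : \bar R :=
  (\sum_(0 <= i <oo) `|p i|%:E)%E.

Definition mutually_independent {R : realType} {d : measure_display}
    {Omega : measurableType d} (P : probability Omega R)
    (X : nat -> Omega -> nat) : Prop :=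
  forall (J : {fset nat}) (B : nat -> set nat),
    P (\bigcap_(m in [set` J]) (X m @^-1` B m)) =
    (\prod_(m <- J) P (X m @^-1` B m))%E.

Definition relaxation {R : realType} {k : scalar_kind} (m : nat) : scalarK R k :=
  1 - (m.+2%:R)^-1.

(* One step from [v] in direction [g]. For [g = 0] the quotient is [0] by the
   library convention, and the step is [alpha *: v]. *)
Definition schwarz_step {R : realType} {k : scalar_kind}
    {V : lmodType (scalarK R k)} (a : V -> V -> scalarK R k) (u : V)
    (alpha : scalarK R k) (v g : V) : V :=
  alpha *: v + (a (u - alpha *: v) g / sreal (form_norm a g ^+ 2)) *: g.

Fixpoint schwarz_iterate {R : realType} {k : scalar_kind}
    {V : lmodType (scalarK R k)} {W : nat -> lmodType (scalarK R k)}
    (a : V -> V -> scalarK R k) (Rop : forall i, {linear W i -> V})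
    (T : forall i, V -> W i) (u : V) (idx : nat -> nat) (m : nat) : V :=
  if m is n.+1 then
    let v := schwarz_iterate a Rop T u idx n in
    schwarz_step a u (relaxation n) v (Rop (idx n) (T (idx n) (u - v)))
  else 0.

(* Main.v *)
Require Import Defs.
From HB Require Import structures.
From mathcomp Require Import all_boot all_order all_algebra.
From mathcomp Require Import finmap.
From mathcomp Require Import all_classical all_reals all_analysis.
From mathcomp Require Import measurable_realfun complex ring lra.

Import Order.TTheory GRing.Theory Num.Theory.
Import numFieldNormedType.Exports.

Local Open Scope classical_set_scope.
Local Open Scope ring_scope.

(**
Write [e = u - u^(m)], [beta = 1 / (m + 2)], and let [x = sum_(i in I) R_i v_i]
with [|v_i| <= H pi_i]. The minimizing step is at least as good as the step of
length [beta H / |T_i e|], whose increment has norm at most [beta H Lambda]; hence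
  [|e'|^2 + 2 (1 - beta) beta H |T_i e| <=
   (1 - beta)^2 |e|^2 + 2 (1 - beta) beta Re a(e, u) + beta^2 K^2],
with [K = |u| + Lambda H]. Averaging over [i] against [pi^(m)] and using
[Re a(e, x) = sum_i Re a_i(T_i e, v_i) <= sum_i pi_i H |T_i e|], the term
[Re a(e, u)] is replaced by [Re a(e, u - x)], up to the l^1 distance of [pi^(m)]
and [pi] times [H Lambda |e|]. Taking expectations, [E |e_m|^2 <= t_m^2] follows
by induction for [t_m = sigma + C / sqrt (m + 1)], [sigma >= |u - x|] and
[C = 2 H Lambda D + 2 K]. Finally [x] approximates [h] with [H = |h| + 1].
*)

(** * Scalars and Hermitian forms *)

Section Scalars.
Context {R : realType} {k : scalar_kind}.
Implicit Types (x y : scalarK R k) (r : R).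

Lemma sre0 : sre (0 : scalarK R k) = 0.
Proof. by case: k. Qed.

Lemma sreD x y : sre (x + y) = sre x + sre y.
Proof. by case: k x y => //= -[? ?] [? ?]. Qed.

Lemma sreMreal r x : sre (sreal r * x) = r * sre x.
Proof. by case: k x => //= -[c d]; rewrite /= mul0r subr0. Qed.

Lemma sre_conj x : sre (sconj x) = sre x.
Proof. by case: k x => //= -[? ?]. Qed.

Lemma srealK r : sre (sreal r : scalarK R k) = r.
Proof. by case: k. Qed.

Lemma sreal1 : sreal 1 = 1 :> scalarK R k.
Proof. by case: k. Qed.

Lemma srealB r1 r2 : sreal (r1 - r2) = sreal r1 - sreal r2 :> scalarK R k.
Proof. by case: k => //=; rewrite raddfB. Qed.

Lemma sreal_natV n : sreal n%:R^-1 = n%:R^-1 :> scalarK R k.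
Proof. by case: k => //=; rewrite fmorphV rmorph_nat. Qed.

Lemma sconj_fixedK x : sconj x = x -> sreal (sre x) = x.
Proof.
case: k x => //= -[c d] [/eqP]; rewrite eq_sym -subr_eq0 opprK -mulr2n.
by rewrite mulrn_eq0 => /eqP ->.
Qed.

Lemma sconj0 : sconj 0 = 0 :> scalarK R k.
Proof. by case: k => //=; rewrite oppr0. Qed.

Lemma sre_le x y : x <= y -> sre x <= sre y.
Proof. by case: k x y => //= -[c d] [c' d'] /andP[]. Qed.

Lemma sre_lt x y : x < y -> sre x < sre y.
Proof. by case: k x y => //= -[c d] [c' d'] /andP[]. Qed.

Lemma sre_ge0 x : 0 <= x -> 0 <= sre x.
Proof. by move/sre_le; rewrite sre0. Qed.

Lemma sreal_gt0 r : 0 < r -> 0 < (sreal r : scalarK R k).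
Proof. by case: k => //=; rewrite ltcR. Qed.

Lemma relaxationE m : relaxation m = sreal (1 - m.+2%:R^-1) :> scalarK R k.
Proof. by rewrite srealB sreal1 sreal_natV. Qed.

End Scalars.

Section HermitianForms.
Context {R : realType} {k : scalar_kind} {V : lmodType (scalarK R k)}.
Variable a : {hermitian_sym V for sconj}.
Implicit Types (x y z : V) (r : R).

Lemma hermsymC x y : a x y = sconj (a y x).
Proof. by rewrite (@hermitian_subproof _ _ _ _ a x y) expr0 mul1r. Qed.

Lemma sre_formC x y : sre (a x y) = sre (a y x).
Proof. by rewrite hermsymC sre_conj. Qed.

Lemma sre_formDl x y z : sre (a (x + y) z) = sre (a x z) + sre (a y z).
Proof. by rewrite linearDl sreD. Qed.

Lemma sre_formDr x y z : sre (a z (x + y)) = sre (a z x) + sre (a z y).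
Proof. by rewrite linearDr sreD. Qed.

Lemma sre_formZl r x y : sre (a (sreal r *: x) y) = r * sre (a x y).
Proof. by rewrite linearZl_LR sreMreal. Qed.

Lemma sre_formZr r x y : sre (a x (sreal r *: y)) = r * sre (a x y).
Proof. by rewrite sre_formC sre_formZl sre_formC. Qed.

Lemma sre_formNr x y : sre (a x (- y)) = - sre (a x y).
Proof.
by apply/eqP; rewrite -subr_eq0 opprK -sre_formDr addNr linear0r sre0.
Qed.

Lemma sre_formNl x y : sre (a (- x) y) = - sre (a x y).
Proof. by rewrite sre_formC sre_formNr sre_formC. Qed.

Lemma sre_formBr x y z : sre (a z (x - y)) = sre (a z x) - sre (a z y).
Proof. by rewrite sre_formDr sre_formNr. Qed.

Lemma sre_form_sumr I (s : seq I) (F : I -> V) x :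
  sre (a x (\sum_(i <- s) F i)) = \sum_(i <- s) sre (a x (F i)).
Proof.
elim: s => [|i s IH]; last by rewrite !big_cons sre_formDr IH.
by rewrite !big_nil linear0r sre0.
Qed.

Lemma sre_form_sqD x y :
  sre (a (x + y) (x + y)) = sre (a x x) + 2 * sre (a x y) + sre (a y y).
Proof. rewrite sre_formDl !sre_formDr (sre_formC y x); lra. Qed.

Lemma form_sq_real x : sreal (sre (a x x)) = a x x.
Proof. by rewrite sconj_fixedK// -hermsymC. Qed.

Hypothesis a_ge0 : forall x, 0 <= sre (a x x).

Lemma form_norm_ge0 x : 0 <= form_norm a x.
Proof. exact: sqrtr_ge0. Qed.

Lemma form_norm_sq x : form_norm a x ^+ 2 = sre (a x x).
Proof. by rewrite sqr_sqrtr. Qed.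

(** A failure of the inequality would make the nonnegative quadratic [t -> |x + t y|^2] negative at
    some real [t]. The form may be degenerate here, so vanishing norms are treated apart. *)
Lemma form_CS x y : sre (a x y) <= form_norm a x * form_norm a y.
Proof.
have key t : 0 <= form_norm a x ^+ 2 + 2 * (t * sre (a x y))
                  + t * (t * form_norm a y ^+ 2).
  have := a_ge0 (x + sreal t *: y).
  by rewrite sre_form_sqD sre_formZl !sre_formZr -!form_norm_sq.
have := form_norm_ge0 x; have := form_norm_ge0 y; move: key.
move: (form_norm a x) (form_norm a y) (sre (a x y)) => X Y b key Y0 X0.
rewrite leNgt; apply/negP => XYb.
have [X00|X00] := eqVneq X 0.
  have [Y00|Y00] := eqVneq Y 0.
    have := key (-1); move: XYb; rewrite X00 Y00; nra.
  have := key (- b / Y ^+ 2); rewrite X00.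
  have -> : - b / Y ^+ 2 * (- b / Y ^+ 2 * Y ^+ 2) = b * b / Y ^+ 2 by field.
  have : 0 < b * b / Y ^+ 2.
    by rewrite divr_gt0// ?exprn_gt0 ?lt_def ?Y00//; move: XYb; rewrite X00; nra.
  lra.
have [Y00|Y00] := eqVneq Y 0.
  have := key (- X ^+ 2 / b).
  have b0 : b != 0 by rewrite gt_eqF//; move: XYb; rewrite Y00; lra.
  have -> : - X ^+ 2 / b * b = - X ^+ 2 by field.
  rewrite Y00; have : 0 < X ^+ 2 by rewrite exprn_gt0// lt_def X00.
  lra.
(* At [t = - X / Y] the quadratic equals [2 * X / Y * (X * Y - b)], which is negative. *)
have := key (- X / Y).
have -> : - X / Y * (- X / Y * Y ^+ 2) = X ^+ 2 by field.
have Yp : 0 < Y by rewrite lt_def Y00.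
have : X / Y * (b - X * Y) > 0.
  by rewrite mulr_gt0// ?divr_gt0// ?lt_def ?X00//; lra.
have -> : X / Y * (b - X * Y) = X / Y * b - X ^+ 2 by field.
lra.
Qed.

Lemma form_norm_triangle x y :
  form_norm a (x + y) <= form_norm a x + form_norm a y.
Proof.
rewrite -(@ler_pXn2r _ 2)// ?nnegrE ?addr_ge0 ?form_norm_ge0//.
rewrite form_norm_sq sre_form_sqD -!form_norm_sq.
have := form_CS x y; nra.
Qed.

Lemma form_normZ r x : 0 <= r -> form_norm a (sreal r *: x) = r * form_norm a x.
Proof.
move=> r0; rewrite /form_norm sre_formZl sre_formZr mulrA -expr2.
by rewrite sqrtrM ?sqr_ge0// sqrtr_sqr ger0_norm.
Qed.

Lemma form_normN x : form_norm a (- x) = form_norm a x.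
Proof. by rewrite /form_norm sre_formNl sre_formNr opprK. Qed.

(* The residual is orthogonal to [g], so the step is at least as good as one
   with any real step length. *)
Lemma schwarz_step_min u alpha v g r :
    (form_norm a g = 0 -> g = 0) ->
  form_norm a (u - schwarz_step a u alpha v g) ^+ 2 <=
  form_norm a (u - alpha *: v - sreal r *: g) ^+ 2.
Proof.
move=> g0; rewrite /schwarz_step opprD addrA.
set z := u - alpha *: v; set w := a z g / _.
have [gz|gn0] := eqVneq (form_norm a g) 0.
  by rewrite (g0 gz) !scaler0.
have orth : a (z - w *: g) g = 0.
  rewrite linearBl linearZl_LR.
  rewrite /w form_norm_sq form_sq_real divfK ?subrr//.
  by apply: contra_neq gn0 => ag0; rewrite /form_norm ag0 sre0 sqrtr0.
have -> : z - sreal r *: g = (z - w *: g) + (w - sreal r) *: g.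
  by rewrite scalerBl addrA subrK.
rewrite !form_norm_sq sre_form_sqD.
have -> : sre (a (z - w *: g) ((w - sreal r) *: g)) = 0.
  have gorth : a g (z - w *: g) = 0 by rewrite hermsymC orth sconj0.
  by rewrite sre_formC linearZl_LR /= gorth mulr0 sre0.
by rewrite mulr0 addr0 lerDl.
Qed.

End HermitianForms.

Lemma dot_sre_ge0 {R : realType} {k : scalar_kind} {V : lmodType (scalarK R k)}
  (a : {dot V for sconj}) (x : V) : 0 <= sre (a x x).
Proof.
have [->|x0] := eqVneq x 0; last by rewrite sre_ge0// ltW// neq0_dnorm_gt0.
by rewrite linear0l sre0.
Qed.

(** * Integrals of discrete random variables *)

Section DiscreteRandomVariables.
Context {R : realType} {d : measure_display} {Omega : measurableType d}.
Variable P : probability Omega R.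
Local Open Scope ereal_scope.
Implicit Types X Y : Omega -> nat.

Lemma nneseries_indic (g : nat -> \bar R) X (w : Omega) :
    (forall a, 0 <= g a) ->
  g (X w) = \sum_(a <oo) g a * (\1_(X @^-1` [set a]) w)%:E.
Proof.
move=> g0; rewrite (@nneseriesD1 _ _ (X w))//; last first.
  by move=> n _; rewrite mule_ge0// lee_fin.
rewrite indicE mem_set//= mule1 eseries0 ?adde0// => i _ Xi.
rewrite indicE memNset ?mule0//= => Xwi.
by move: Xi; rewrite Xwi eqxx.
Qed.

(** [nat] carries the discrete sigma-algebra, so every [g] is measurable. *)
Lemma measurable_comp_nat {d'} {T : measurableType d'} X (g : nat -> T) :
  measurable_fun setT X -> measurable_fun setT (fun w => g (X w)).
Proof. by move=> mX; apply: (measurableT_comp _ mX) => ? ? ?. Qed.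

Lemma integral_nat_indic X (E : set Omega) (g : nat -> \bar R) :
    measurable_fun setT X -> measurable E -> (forall a, 0 <= g a) ->
  \int[P]_w (g (X w) * (\1_E w)%:E) =
  \sum_(a <oo) g a * P (X @^-1` [set a] `&` E).
Proof.
move=> mX mE g0.
have mXa a : measurable (X @^-1` [set a]).
  by rewrite -[X in measurable X]setTI; exact: mX.
have mXE a : measurable (X @^-1` [set a] `&` E) by exact: measurableI.
transitivity (\int[P]_w \sum_(a <oo) g a * (\1_(X @^-1` [set a] `&` E) w)%:E).
  apply: eq_integral => w _.
  rewrite (nneseries_indic _ X w)//.
  have [Ew|Ew] := boolP (w \in E).
    rewrite !indicE Ew mule1; apply: eq_eseriesr => a _.
    by rewrite !indicE in_setI Ew andbT.
  rewrite [\1_E w]indicE (negbTE Ew) mule0 eseries0// => a _ _.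
  by rewrite indicE in_setI (negbTE Ew) andbF mule0.
rewrite integral_nneseries//.
- apply: eq_eseriesr => a _.
  rewrite ge0_integralZl//.
  + by rewrite integral_indic// setIT.
  + by apply/measurable_EFinP; exact: measurable_indic.
- move=> a; apply: emeasurable_funM; first exact: measurable_cst.
  by apply/measurable_EFinP; exact: measurable_indic.
- by move=> a w _; rewrite mule_ge0// lee_fin.
Qed.

(** Both sides expand, along the values [b] of [Y] and then [a] of [X], into the double series of
    [g a b * P (X = a) * p b]. This integrates out [Y] with [X] frozen. *)
Lemma integral_indep_nat X Y (p : nat -> R) (g : nat -> nat -> \bar R) :
    measurable_fun setT X -> measurable_fun setT Y ->
    (forall b, (0 <= p b)%R) -> (forall a b, 0 <= g a b) ->
    (forall a b, P (X @^-1` [set a] `&` Y @^-1` [set b]) =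
                 P (X @^-1` [set a]) * (p b)%:E) ->
  \int[P]_w g (X w) (Y w) = \int[P]_w \sum_(b <oo) (p b)%:E * g (X w) b.
Proof.
move=> mX mY p0 g0 indep.
have mYb b : measurable (Y @^-1` [set b]).
  by rewrite -[X in measurable X]setTI; exact: mY.
have mgX b : measurable_fun setT (fun w => g (X w) b).
  exact: (measurable_comp_nat _ (g^~ b)).
transitivity (\int[P]_w \sum_(b <oo) g (X w) b * (\1_(Y @^-1` [set b]) w)%:E).
  by apply: eq_integral => w _; exact: (nneseries_indic (g (X w))).
rewrite integral_nneseries//; last 2 first.
- move=> b; apply: emeasurable_funM => //.
  by apply/measurable_EFinP; exact: measurable_indic.
- by move=> b w _; rewrite mule_ge0// lee_fin.
rewrite integral_nneseries//; last 2 first.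
- by move=> b; apply: emeasurable_funM => //; exact: measurable_cst.
- by move=> b w _; rewrite mule_ge0// lee_fin.
apply: eq_eseriesr => b _.
rewrite (integral_nat_indic X _ (g^~ b))// ge0_integralZl//; last first.
  by rewrite lee_fin.
(* The indicator of the whole space is inserted to reuse [integral_nat_indic]. *)
rewrite (_ : \int[P]_w g (X w) b =
              \int[P]_w (g (X w) b * (\1_setT w)%:E)); last first.
  by apply: eq_integral => w _; rewrite indicT mule1.
rewrite (integral_nat_indic X setT (g^~ b))//.
rewrite -nneseriesZl; last by move=> a _; rewrite mule_ge0.
apply: eq_eseriesr => a _; rewrite setIT.
by rewrite indep muleA [RHS]muleC.
Qed.

End DiscreteRandomVariables.

(** * The past indices as one discrete random variable *)

Section History.
Context {R : realType} {d : measure_display} {Omega : measurableType d}.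
Variables (P : probability Omega R) (idx : nat -> {RV P >-> nat}).

(* Coding the past indices by one natural number makes them a discrete random
   variable, to be paired with the next index. *)
Definition history (m : nat) (w : Omega) : nat :=
  choice.pickle (mkseq (fun n => idx n w) m).

(** Numbers that code no sequence decode to the empty one, and positions past the end give [0], so
    the function is total. *)
Definition index_of_code (a : nat) : nat -> nat :=
  nth 0%N (odflt [::] (choice.unpickle a)).

Lemma index_of_history m w n : (n < m)%N ->
  index_of_code (history m w) n = idx n w.
Proof. by move=> nm; rewrite /index_of_code choice.pickleK /= nth_mkseq. Qed.

(** A code is attained only if decoding [m] indices and encoding them again returns it. The event is
    then a finite intersection of events on single indices, the form to which mutual independence
    applies. *)
Lemma history_preimage m a : history m @^-1` [set a] =
  if choice.pickle (mkseq (index_of_code a) m) == a then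
    \bigcap_(n in [set` [fset n in iota 0 m]%fset])
      (idx n @^-1` [set index_of_code a n])
  else set0.
Proof.
have mkE w : mkseq (index_of_code (history m w)) m = mkseq (fun n => idx n w) m.
  by apply/eq_in_map => n; rewrite mem_iota => nm; exact: index_of_history.
case: ifPn => [/eqP am|am].
  apply/seteqP; split => w /=.
    move=> <- n /=; rewrite !inE/= mem_iota add0n => nm.
    by rewrite index_of_history.
  move=> wa; rewrite -[RHS]am; congr choice.pickle; apply/eq_in_map => n nm.
  by apply: wa; rewrite /= !inE.
rewrite -subset0 => w /= wa; move/eqP: am; apply.
by rewrite -wa mkE.
Qed.

Lemma measurable_preimage_idx m (B : set nat) : measurable (idx m @^-1` B).
Proof. by rewrite -[X in measurable X]setTI; exact: measurable_funPT. Qed.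

Lemma measurable_history m : measurable_fun setT (history m).
Proof.
move=> _ B _; rewrite setTI.
have -> : history m @^-1` B = \bigcup_(a in B) history m @^-1` [set a].
  by apply/seteqP; split=> [w Bw|w [a Ba /= ->]//]; exists (history m w).
apply: bigcup_measurable => a _; rewrite history_preimage.
case: ifP => // _; apply: fin_bigcap_measurable => // n _.
exact: measurable_preimage_idx.
Qed.

Hypothesis indep : mutually_independent P (fun m => idx m).

(** The past event is an intersection over [n < m]; adjoining [m] to this index set makes the joint
    event another instance of mutual independence, and the two products differ by the factor at
    [m]. *)
Lemma history_indep m a b :
  (P (history m @^-1` [set a] `&` idx m @^-1` [set b]) =
   P (history m @^-1` [set a]) * P (idx m @^-1` [set b]))%E.
Proof.
rewrite history_preimage; case: ifP => _; last by rewrite set0I measure0 mul0e.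
set J := [fset n in iota 0 m]%fset; set B := fun n => [set index_of_code a n].
have mJ : m \notin J by rewrite !inE/= mem_iota ltnn andbF.
pose B' n := if n == m then [set b] else B n.
have -> : \bigcap_(n in [set` J]) (idx n @^-1` B n) `&` idx m @^-1` [set b] =
  \bigcap_(n in [set` (m |` J)%fset]) (idx n @^-1` B' n).
  apply/seteqP; split => w /=.
    move=> [wJ wb] n /=; rewrite /B' in_fset1U.
    by case: eqVneq => [->//|_] /= nJ; exact: wJ.
  move=> wJ; split; last first.
    by have := wJ m; rewrite /= in_fset1U /B' eqxx; exact.
  move=> n /= nJ; have := wJ n; rewrite /= in_fset1U nJ orbT /B'.
  by case: eqVneq nJ mJ => [->->//|_ _ _]; exact.
rewrite (indep _ B') (indep J B) big_fsetU1//= muleC /B' eqxx; congr (_ * _)%E.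
apply: eq_big_seq => n nJ; case: eqVneq nJ mJ => // -> ->//.
Qed.

End History.

(** * One step of the iteration *)

Section OneStep.
Context {R : realType} {k : scalar_kind} {V : lmodType (scalarK R k)}
  {W : nat -> lmodType (scalarK R k)}.
Variables (a : {hermitian_sym V for sconj}) (aW : forall i, {dot (W i) for sconj}).
Variables (Rop : forall i, {linear W i -> V}) (T : forall i, V -> W i) (L : R).
Hypothesis a_ge0 : forall x, 0 <= sre (a x x).
Hypothesis a_def : forall x, form_norm a x = 0 -> x = 0.
Hypothesis L_ge0 : 0 <= L.
Hypothesis Rop_bound :
  forall i (w : W i), form_norm a (Rop i w) <= L * form_norm (aW i) w.
Hypothesis T_adj : forall i (v : V) (w : W i), aW i (T i v) w = a v (Rop i w).

Lemma adjoint_sq i e :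
  form_norm (aW i) (T i e) ^+ 2 = sre (a e (Rop i (T i e))).
Proof. by rewrite -T_adj; exact: (form_norm_sq (aW i) (dot_sre_ge0 (aW i))). Qed.

(** [T i] inherits the bound of its adjoint [Rop i]: apply Cauchy-Schwarz to [adjoint_sq] and divide
    by the norm of [T i e] when it is positive. *)
Lemma adjoint_bound i e : form_norm (aW i) (T i e) <= L * form_norm a e.
Proof.
have : form_norm (aW i) (T i e) ^+ 2 <=
       form_norm a e * (L * form_norm (aW i) (T i e)).
  rewrite adjoint_sq (le_trans (form_CS a a_ge0 _ _))// ler_wpM2l ?form_norm_ge0//.
have := form_norm_ge0 (aW i) (T i e).
rewrite le0r => /orP[/eqP-> _|Tp].
  by rewrite mulr_ge0// form_norm_ge0.
by rewrite mulrA expr2 ler_pM2r// mulrC.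
Qed.

(* The exact step is compared with the step length [beta * H / |T_i e|], for
   which the increment has norm at most [beta * H * L]. *)
Lemma schwarz_step_bound (u v : V) (beta H : R) i : 0 <= beta <= 1 -> 0 <= H ->
  form_norm a (u - schwarz_step a u (sreal (1 - beta)) v
                     (Rop i (T i (u - v)))) ^+ 2
    + 2 * (1 - beta) * beta * (H * form_norm (aW i) (T i (u - v))) <=
  (1 - beta) ^+ 2 * form_norm a (u - v) ^+ 2
    + 2 * (1 - beta) * beta * sre (a (u - v) u)
    + beta ^+ 2 * (form_norm a u + L * H) ^+ 2.
Proof.
move=> /andP[b0 b1] H0; set e := u - v; set g := Rop i _.
(* When [t = 0] the quotient [r] is [0] by convention, and [rt2] and [rt] still hold. *)
pose t := form_norm (aW i) (T i e); pose r := beta * H / t.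
have t0 : 0 <= t by exact: form_norm_ge0.
have r0 : 0 <= r by rewrite divr_ge0 ?mulr_ge0.
have rt2 : r * t ^+ 2 = beta * (H * t).
  rewrite /r; have [->|tn0] := eqVneq t 0; first by rewrite expr0n/= !mulr0.
  by field.
have rt : r * t <= beta * H.
  rewrite /r; have [->|tn0] := eqVneq t 0; first by rewrite mulr0 mulr_ge0.
  by rewrite divfK.
have aeg : sre (a e g) = t ^+ 2 by rewrite /t adjoint_sq.
(* The error splits into the contracted old error and a small increment, because
   [u - (1 - beta) v = (1 - beta) e + beta u]. *)
have zE : u - sreal (1 - beta) *: v - sreal r *: g =
    sreal (1 - beta) *: e + (sreal beta *: u - sreal r *: g).
  rewrite addrA; congr (_ - _).
  by rewrite /e scalerBr addrAC -scalerDl srealB sreal1 subrK scale1r.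
have step := @schwarz_step_min _ _ _ a a_ge0 u (sreal (1 - beta)) v g r (a_def g).
rewrite zE in step.
have small : form_norm a (sreal beta *: u - sreal r *: g) <=
    beta * (form_norm a u + L * H).
  rewrite (le_trans (form_norm_triangle _ a_ge0 _ _))// form_normN !form_normZ//.
  rewrite mulrDr lerD2l [leRHS]mulrCA.
  rewrite (le_trans (ler_wpM2l r0 (Rop_bound _ _)))//.
  by rewrite -/t [leLHS]mulrCA ler_wpM2l.
have small2 : form_norm a (sreal beta *: u - sreal r *: g) ^+ 2 <=
    beta ^+ 2 * (form_norm a u + L * H) ^+ 2.
  by rewrite -exprMn ler_pXn2r// nnegrE ?form_norm_ge0//
    mulr_ge0// addr_ge0 ?form_norm_ge0 ?mulr_ge0.
have expand : form_norm a (sreal (1 - beta) *: e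
                 + (sreal beta *: u - sreal r *: g)) ^+ 2 =
    (1 - beta) ^+ 2 * form_norm a e ^+ 2
    + 2 * (1 - beta) * (beta * sre (a e u) - beta * (H * t))
    + form_norm a (sreal beta *: u - sreal r *: g) ^+ 2.
  rewrite form_norm_sq// sre_form_sqD -!form_norm_sq//.
  rewrite form_normZ ?subr_ge0// sre_formZl sre_formBr !sre_formZr aeg rt2.
  by ring.
rewrite expand in step; rewrite -/t.
move: step small2.
set S := form_norm a (u - _) ^+ 2; set Q := form_norm a (_ - _) ^+ 2.
move=> step small2; nra.
Qed.

(** Move each [Rop i] onto [e] as [T i], then apply Cauchy-Schwarz in [W i] and bound the norm of
    [v i] by [pi i * H]. *)
Lemma sre_form_span_le (I : {fset nat}) (v : forall i, W i) (pi : nat -> R) H e :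
    (forall i, 0 < pi i) ->
    (forall i, i \in I -> (pi i)^-1 * form_norm (aW i) (v i) <= H) ->
  sre (a e (\sum_(i <- I) Rop i (v i))) <=
  \sum_(i <- I) pi i * (H * form_norm (aW i) (T i e)).
Proof.
move=> pi0 vH; rewrite sre_form_sumr big_seq [leRHS]big_seq.
apply: ler_sum => i iI; rewrite -T_adj.
have aW0 := dot_sre_ge0 (aW i).
rewrite (le_trans (form_CS (aW i) aW0 _ _))// mulrC mulrA.
rewrite ler_wpM2r ?form_norm_ge0//.
by have := vH i iI; rewrite ler_pdivrMl.
Qed.

(** Summing [schwarz_step_bound] against [p] produces the gain [sum_i p_i H |T_i e|], which
    dominates [Re a(e, x)] up to the distance of [p] from [pi]; subtracting it turns [Re a(e, u)]
    into [Re a(e, u - x)]. *)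
Lemma expected_step_bound (u v : V) (beta H eta : R) (p pi : nat -> R)
    (I : {fset nat}) (y : forall i, W i) (x := \sum_(i <- I) Rop i (y i)) :
    0 <= beta <= 1 -> 0 <= H ->
    discrete_distribution p -> (forall i, 0 < pi i) ->
    (l1_norm (fun i => p i - pi i)%R <= eta%:E)%E ->
    (forall i, i \in I -> (pi i)^-1 * form_norm (aW i) (y i) <= H) ->
  (\sum_(i <oo) (p i)%:E * (form_norm a (u - schwarz_step a u (sreal (1 - beta)) v
                     (Rop i (T i (u - v)))) ^+ 2)%:E <=
  ((1 - beta) ^+ 2 * form_norm a (u - v) ^+ 2
    + 2 * (1 - beta) * beta *
        (sre (a (u - v) (u - x)) + H * L * form_norm a (u - v) * eta)
    + beta ^+ 2 * (form_norm a u + L * H) ^+ 2)%:E)%E.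
Proof.
move=> b01 H0 [p0 p1] pi0 ppi yH; have /andP[b0 b1] := b01.
pose Phi i := form_norm a (u - schwarz_step a u (sreal (1 - beta)) v
                     (Rop i (T i (u - v)))) ^+ 2.
rewrite -/(Phi _); set e := u - v.
pose t i := H * form_norm (aW i) (T i e).
have t0 i : 0 <= t i by rewrite mulr_ge0 ?form_norm_ge0.
pose M := H * L * form_norm a e.
have tM i : t i <= M by rewrite /M -mulrA ler_wpM2l// adjoint_bound.
have M0 : 0 <= M by exact: le_trans (tM 0%N).
pose B := 2 * (1 - beta) * beta.
have B0 : 0 <= B by rewrite !mulr_ge0// subr_ge0.
set A1 := (1 - beta) ^+ 2 * _; set A2 := beta ^+ 2 * _.
pose A := A1 + B * sre (a e u) + A2.
have PhiA i : Phi i + B * t i <= A by exact: schwarz_step_bound.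
have Phi0 i : 0 <= Phi i by exact: sqr_ge0.
have A0 : 0 <= A.
  by rewrite (le_trans _ (PhiA 0%N))// addr_ge0// mulr_ge0.
have sum1 : (\sum_(i <oo) (p i)%:E * (Phi i)%:E
             + B%:E * \sum_(i <oo) (p i)%:E * (t i)%:E <= A%:E)%E.
  rewrite -nneseriesZl; last by move=> i _; rewrite -EFinM lee_fin mulr_ge0.
  rewrite -nneseriesD; last 2 first.
  - by move=> i _ _; rewrite -EFinM lee_fin mulr_ge0.
  - by move=> i _ _; rewrite -!EFinM lee_fin mulr_ge0// mulr_ge0.
  rewrite -[leRHS]mule1 -p1 -nneseriesZl; last by move=> i _; rewrite lee_fin.
  apply: lee_nneseries => i _; rewrite -!EFinM -EFinD lee_fin.
    by rewrite addr_ge0// mulr_ge0// mulr_ge0.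
  by rewrite [B * _]mulrCA -mulrDr [leRHS]mulrC ler_wpM2l.
(* Enlarge the finite sum over [I] to the full series with weights [pi], then trade [pi] for [p]:
   since every [t i <= M], the exchange costs at most [M * eta]. *)
have sum2 : ((sre (a e x))%:E <= \sum_(i <oo) (p i)%:E * (t i)%:E + (M * eta)%:E)%E.
  apply: (@le_trans _ _ (\sum_(i <oo) (pi i * t i)%:E)%E).
    apply: (@le_trans _ _ (\sum_(i <- I) (pi i * t i)%:E)%E).
      by rewrite sumEFin lee_fin; exact: sre_form_span_le.
    by apply: (lee_sum_fset_lim I) => i _; rewrite lee_fin mulr_ge0// ltW.
  apply: (@le_trans _ _ (\sum_(i <oo) (p i)%:E * (t i)%:E
                         + M%:E * l1_norm (fun i => p i - pi i)%R)%E); last first.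
    by rewrite leeD2l// [(M * eta)%:E]EFinM lee_wpmul2l.
  rewrite /l1_norm -nneseriesZl; last by move=> i _; rewrite lee_fin.
  rewrite -nneseriesD; last 2 first.
  - by move=> i _ _; rewrite -EFinM lee_fin mulr_ge0.
  - by move=> i _ _; rewrite -!EFinM lee_fin mulr_ge0.
  apply: lee_nneseries => i _; first by rewrite lee_fin mulr_ge0// ltW.
  rewrite -!EFinM -EFinD lee_fin -lerBlDl -mulrBl.
  rewrite (le_trans (ler_norm _))// normrM (ger0_norm (t0 i)) distrC mulrC.
  by rewrite ler_wpM2r.
have Z0 : (0 <= \sum_(i <oo) (p i)%:E * (t i)%:E)%E.
  by apply: nneseries_ge0 => i _ _; rewrite -EFinM lee_fin mulr_ge0.
have F0 : (0 <= \sum_(i <oo) (p i)%:E * (Phi i)%:E)%E.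
  by apply: nneseries_ge0 => i _ _; rewrite -EFinM lee_fin mulr_ge0.
(* The averaged gain is finite, as [p] has mass one. With nonnegativity and [sum1], this excludes
   infinite values of both series in the case analysis below. *)
have ZM : (\sum_(i <oo) (p i)%:E * (t i)%:E <= M%:E)%E.
  rewrite -[leRHS]mule1 -p1 -nneseriesZl; last by move=> i _; rewrite lee_fin.
  apply: lee_nneseries => i _; first by rewrite -EFinM lee_fin mulr_ge0.
  by rewrite -!EFinM lee_fin mulrC ler_wpM2r.
move: sum1 sum2 Z0 F0 ZM.
case: (\sum_(i <oo) (p i)%:E * (t i)%:E)%E => [z| |]; [|by []..].
case: (\sum_(i <oo) (p i)%:E * (Phi i)%:E)%E => [f| |]; [|by []..].
rewrite -EFinM -!EFinD !lee_fin => sum1 sum2 _ _ _.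
rewrite sre_formBr -/B -/M /A in sum1 *.
have := ler_wpM2l B0 sum2; lra.
Qed.

End OneStep.

(** * Approximation by the span *)

Lemma sre_le_rnorm {R : realType} {k} (x : scalarK R k) : sre x <= rnorm x.
Proof.
case: k x => [x|[c d]]; rewrite /rnorm /=; first exact: ler_norm.
by rewrite (le_trans (ler_norm _))// -sqrtr_sqr ler_wsqrtr// lerDl sqr_ge0.
Qed.

Lemma rnorm_ge0 {R : realType} {k} {V : normedZmodType (scalarK R k)} (v : V) :
  0 <= rnorm v.
Proof. exact/sre_ge0/normr_ge0. Qed.

Lemma rnorm_gt0 {R : realType} {k} {V : normedZmodType (scalarK R k)} (v : V) :
  v != 0 -> 0 < rnorm v.
Proof. by rewrite -normr_gt0 => /sre_lt; rewrite sre0. Qed.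

Lemma form_norm_le_rnorm {R : realType} {k} {V : normedModType (scalarK R k)}
    (a : V -> V -> scalarK R k) : continuous_form a ->
  exists2 M : R, 0 < M & forall v, form_norm a v <= M * rnorm v.
Proof.
(* [M] may have any sign; [1 + |M|] is positive and its square dominates [M]. *)
move=> [M aM]; have M1 : 0 < 1 + `|M| by rewrite ltr_pwDl.
exists (1 + `|M|) => // v.
have Mv : 0 <= (1 + `|M|) * rnorm v by rewrite mulr_ge0 ?rnorm_ge0// ltW.
rewrite -(ger0_norm Mv) -[leRHS]sqrtr_sqr ler_wsqrtr//.
rewrite (le_trans (sre_le_rnorm _))// (le_trans (aM v v))//.
rewrite exprMn expr2 -mulrA -expr2 ler_wpM2r ?sqr_ge0//.
have := ler_norm M; have := normr_ge0 M; nra.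
Qed.

(** Density puts some [j x] near [h], and continuity of [iota] brings [x] near [iota h] as well. The
    norm of [j x] is an infimum over decompositions of [x], so one of them has its maximum below
    [rnorm h + 1]. *)
Lemma span_approximation {R : realType} {k}
    {V : normedModType (scalarK R k)} {W : nat -> lmodType (scalarK R k)}
    (a : V -> V -> scalarK R k) (aW : forall i, {dot (W i) for sconj})
    (Rop : forall i, {linear W i -> V}) (pi : nat -> R)
    (A : completeNormedModType (scalarK R k)) (j : V -> A) (iota : A -> V)
    (h : A) (eps : R) :
    continuous_form a -> (forall i, 0 < pi i) ->
    is_completion (splitting_span Rop) (approx_norm aW Rop pi) j ->
    extends_inclusion (splitting_span Rop) j iota -> 0 < eps ->
  exists (I : {fset nat}) (y : forall i, W i),
    (forall i, i \in I -> (pi i)^-1 * form_norm (aW i) (y i) <= rnorm h + 1) /\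
    form_norm a (iota h - \sum_(i <- I) Rop i (y i)) <= eps.
Proof.
move=> /form_norm_le_rnorm[M M0 aM] pi0 [_ jN jdense] [ciota iotaj] eps0.
have d0 : 0 < eps / M by rewrite divr_gt0.
(* The first condition yields the error [eps] after multiplication by [M]; the second keeps the norm
   of [y] below [rnorm h + 1]. *)
pose B := [set y | `|iota h - iota y| < sreal (eps / M) /\
                   `|h - y| < sreal 1].
have near_h : \forall y \near h, B y.
  near=> y; split; near: y.
    by move/cvgrPdist_lt : (ciota h); apply; exact: sreal_gt0.
  have /cvgrPdist_lt := @cvg_id _ (nbhs h); apply; exact: sreal_gt0.
have [|z [/interior_subset Bz [x Sx jx]]] := jdense B^° _ (@open_interior _ B).
  by exists h; exact: near_h.
move: Bz; rewrite -jx => -[]; rewrite iotaj// => /sre_lt + /sre_lt.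
rewrite !srealK => iotax hjx.
have Nx : approx_norm aW Rop pi x < rnorm h + 1.
  rewrite -jN// (le_lt_trans _ (_ : rnorm h + sre `|h - j x| < _)) ?ltrD2l//.
  rewrite /rnorm -sreD sre_le// -[j x in leLHS](subKr h).
  by rewrite (le_trans (ler_normB _ _)).
have [I [y [xE ylt]]] : exists (I : {fset nat}) (y : forall i, W i),
    x = \sum_(i <- I) Rop i (y i) /\
    \big[Num.max/0]_(i <- I) ((pi i)^-1 * form_norm (aW i) (y i)) < rnorm h + 1.
  (* The infimum is over a nonempty set because [x] lies in the span. *)
  have [|_ [I [y [xE ->]]] ylt] := inf_lt _ Nx; last by exists I, y.
  by have [I [y xE]] := Sx; eexists; exists I, y; split.
exists I, y; split => [i iI|].
  rewrite (le_trans _ (ltW ylt))//.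
  exact: (le_bigmax_seq 0 i xpredT
    (fun i => (pi i)^-1 * form_norm (aW i) (y i))).
rewrite -xE (le_trans (aM _))// -ler_pdivlMl// mulrC; exact: ltW.
Unshelve. all: end_near.
Qed.

(** * Convergence rate *)

(* The invariant propagates because, with [S ^+ 2 = s ^+ 2 + 1], the gap
   [C * S - (C * s + c / S)] is at least [K / S]. *)
Lemma rate_step {R : realType} (m : nat) (sigma c K : R)
    (rho := fun n : nat => n.+1%:R `^ (- 2^-1))
    (t := fun n => sigma + (2 * c + 2 * K) * rho n)
    (beta := m.+2%:R^-1 : R) :
    0 <= sigma -> 0 <= c -> 0 <= K ->
  (1 - beta) ^+ 2 * t m ^+ 2
    + 2 * (1 - beta) * beta * ((sigma + c * rho m.+1) * t m)
    + beta ^+ 2 * K ^+ 2 <= t m.+1 ^+ 2.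
Proof.
move=> sigma0 c0 K0.
pose s : R := Num.sqrt m.+1%:R; pose S : R := Num.sqrt m.+2%:R.
have s0 : 0 < s by rewrite sqrtr_gt0.
have S0 : 0 < S by rewrite sqrtr_gt0.
have s2 : s ^+ 2 = m.+1%:R by rewrite sqr_sqrtr.
have S2 : S ^+ 2 = m.+2%:R by rewrite sqr_sqrtr.
have Ss : S ^+ 2 = s ^+ 2 + 1 by rewrite s2 S2 -natr1.
have rhoE n : rho n = (Num.sqrt n.+1%:R)^-1 by rewrite /rho powRN powR12_sqrt.
rewrite /t !rhoE -/s -/S /beta -S2.
set C := 2 * c + 2 * K.
have C0 : 0 <= C by rewrite addr_ge0 ?mulr_ge0.
have sS : s <= S by rewrite ler_sqrt ?ler_nat.
(* After multiplication by [S ^+ 4] the right side is [(A + Z) ^+ 2], and the left side is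
   [(A + Y) ^+ 2 + K ^+ 2] minus [(sigma + c / S) ^+ 2]. *)
pose Y := C * s + c / S; pose Z := C * S; pose A := S ^+ 2 * sigma.
have A0 : 0 <= A by rewrite mulr_ge0 ?sqr_ge0.
have Y0 : 0 <= Y by rewrite addr_ge0 ?divr_ge0 ?mulr_ge0// ltW.
have gap : K / S <= Z - Y.
  have -> : Z - Y = C * (S - s) - c / S by rewrite /Z /Y; ring.
  (* This holds since [(S - s) * (S + s) = 1] and [S + s <= 2 * S]. *)
  have : 1 / (2 * S) <= S - s.
    rewrite ler_pdivrMr ?mulr_gt0//; nra.
  move=> /(ler_wpM2l C0); have -> : C * (1 / (2 * S)) = c / S + K / S.
    by rewrite /C; field; rewrite gt_eqF.
  lra.
have KS0 : 0 <= K / S by rewrite divr_ge0// ltW.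
(* The difference of squares is [(Z - Y) * (2 * A + Y + Z)], at least [K / S * Z = K * C], and
   [C >= 2 * K]. *)
have key : (A + Y) ^+ 2 + K ^+ 2 <= (A + Z) ^+ 2.
  have KC : K ^+ 2 <= K / S * Z.
    have -> : K / S * Z = K * C by rewrite /Z; field; rewrite gt_eqF.
    rewrite /C; nra.
  have : K / S * Z <= (Z - Y) * (2 * A + Y + Z).
    apply: ler_pM => //; first by rewrite mulr_ge0// ltW.
    by rewrite lerDr; move: A0 Y0; lra.
  have -> : (A + Z) ^+ 2 = (A + Y) ^+ 2 + (Z - Y) * (2 * A + Y + Z) by ring.
  lra.
have sV : 1 - (S ^+ 2)^-1 = s ^+ 2 / S ^+ 2.
  by rewrite Ss; field; rewrite -Ss sqrf_eq0 gt_eqF.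
have S40 : 0 < S ^+ 4 by rewrite exprn_gt0.
rewrite sV -(ler_pM2l S40).
apply: le_trans (_ : _ <= (A + Z) ^+ 2) _; last first.
  rewrite le_eqVlt; apply/orP; left; apply/eqP.
  by rewrite /A /Z; field; rewrite gt_eqF.
apply: le_trans key.
have -> : A + Y = s ^+ 2 * (sigma + C / s) + (sigma + c / S).
  by rewrite /A /Y Ss; field; rewrite !gt_eqF.
have -> : S ^+ 4 * ((s ^+ 2 / S ^+ 2) ^+ 2 * (sigma + C / s) ^+ 2 +
   2 * (s ^+ 2 / S ^+ 2) / S ^+ 2 * ((sigma + c / S) * (sigma + C / s)) +
   (S ^+ 2)^-1 ^+ 2 * K ^+ 2) =
   (s ^+ 2 * (sigma + C / s)) ^+ 2 +
   2 * (s ^+ 2 * (sigma + C / s)) * (sigma + c / S) + K ^+ 2.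
  by field; rewrite !gt_eqF.
(* Completing the square leaves the surplus [(sigma + c / S) ^+ 2], which is nonnegative and is
   dropped. *)
rewrite lerD2r sqrrD -mulr_natl !mulrA; have := sqr_ge0 (sigma + c / S); lra.
Qed.

(** Allows the true indices to be replaced by those decoded from [history], which makes iterate [m]
    a function of the past alone. *)
Lemma eq_schwarz_iterate {R : realType} {k} {V : lmodType (scalarK R k)}
    {W : nat -> lmodType (scalarK R k)} (a : V -> V -> scalarK R k)
    (Rop : forall i, {linear W i -> V}) (T : forall i, V -> W i) u
    (i1 i2 : nat -> nat) m :
    (forall n, (n < m)%N -> i1 n = i2 n) ->
  schwarz_iterate a Rop T u i1 m = schwarz_iterate a Rop T u i2 m.
Proof.
elim: m => //= m IH i12; rewrite i12// IH// => n nm.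
by rewrite i12// ltnS ltnW.
Qed.

(** * Induction on the mean square error *)

Section MeanSquare.
Context {R : realType} {k : scalar_kind} {V : lmodType (scalarK R k)}
  {W : nat -> lmodType (scalarK R k)}.
Variables (a : {hermitian_sym V for sconj}) (aW : forall i, {dot (W i) for sconj}).
Variables (Rop : forall i, {linear W i -> V}) (T : forall i, V -> W i) (L : R).
Hypothesis a_ge0 : forall x, 0 <= sre (a x x).
Hypothesis a_def : forall x, form_norm a x = 0 -> x = 0.
Hypothesis L_ge0 : 0 <= L.
Hypothesis Rop_bound :
  forall i (w : W i), form_norm a (Rop i w) <= L * form_norm (aW i) w.
Hypothesis T_adj : forall i (v : V) (w : W i), aW i (T i v) w = a v (Rop i w).
Context {d : measure_display} {Omega : measurableType d}.
Variables (P : probability Omega R) (idx : nat -> {RV P >-> nat}).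
Variables (pi : nat -> R) (pim : nat -> nat -> R) (D : R).
Hypothesis pi_gt0 : forall i, 0 < pi i.
Hypothesis pimP : forall m, discrete_distribution (pim m).
Hypothesis D_ge0 : 0 <= D.
Hypothesis pim_close : forall m, (l1_norm (fun i => (pim m i - pi i)%R)
              <= (D * m.+2%:R `^ (- 2^-1))%:E)%E.
Hypothesis idx_indep : mutually_independent P (fun m => idx m).
Hypothesis idx_law : forall m i, P (idx m @^-1` [set i]) = (pim m i)%:E.

(** Induction on [m]: conditioning on the past gives the sum bounded by [expected_step_bound]; a
    bound linear in the squared error is integrated using the induction hypothesis, and [rate_step]
    concludes. *)
Lemma mean_square_bound (u : V) (I : {fset nat}) (y : forall i, W i)
    (H sigma : R) (m : nat) :
    0 <= H -> 0 < sigma ->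
    (forall i, i \in I -> (pi i)^-1 * form_norm (aW i) (y i) <= H) ->
    form_norm a (u - \sum_(i <- I) Rop i (y i)) <= sigma ->
  (\int[P]_w (form_norm a (u - schwarz_iterate a Rop T u
                                 (fun n => idx n w) m) ^+ 2)%:E <=
   ((sigma + (2 * (H * L * D) + 2 * (form_norm a u + L * H))
               * m.+1%:R `^ (- 2^-1)) ^+ 2)%:E)%E.
Proof.
move=> H0 sigma0 yH ux.
set c := H * L * D; set K := form_norm a u + L * H.
have c0 : 0 <= c by rewrite !mulr_ge0.
have nu0 := form_norm_ge0 a u.
have K0 : 0 <= K by rewrite addr_ge0// mulr_ge0.
elim: m => [|m IH].
  (* The initial iterate is zero, so the error is [|u| <= K], and the rate factor at [m = 0] is
     [1]. *)
  rewrite /= subr0 integral_cst//= probability_setT mule1 lee_fin powR1 mulr1.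
  rewrite ler_pXn2r ?nnegrE//; last by rewrite addr_ge0 ?addr_ge0 ?mulr_ge0// ltW.
  have : form_norm a u <= K by rewrite lerDl mulr_ge0.
  by move: nu0; lra.
(* The past enters only through the code [h], the new choice only through the index [i]. *)
pose v (h : nat) := schwarz_iterate a Rop T u (index_of_code h) m.
pose Phi (h i : nat) := form_norm a (u - schwarz_step a u (relaxation m) (v h)
                        (Rop i (T i (u - v h)))) ^+ 2.
have iterE w : schwarz_iterate a Rop T u (fun n => idx n w) m =
               v (history P idx m w).
  by apply: eq_schwarz_iterate => n nm; rewrite index_of_history.
under eq_integral do rewrite /= iterE -/(Phi _ _).
have intE : (\int[P]_w (form_norm a (u - schwarz_iterate a Rop T u
                                 (fun n => idx n w) m) ^+ 2)%:E =
   \int[P]_w (form_norm a (u - v (history P idx m w)) ^+ 2)%:E)%E.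
  by apply: eq_integral => w _; rewrite iterE.
rewrite {}intE in IH.
have mh := measurable_history P idx m.
have [p0 p1] := pimP m.
have Phi0 h i : (0 <= (Phi h i)%:E)%E by rewrite lee_fin sqr_ge0.
rewrite (integral_indep_nat P (history P idx m) (idx m) (pim m)
          (fun h i => (Phi h i)%:E))//; last first.
  by move=> h i; rewrite -idx_law; exact: history_indep.
set rho := fun n : nat => (n.+1%:R : R) `^ (- 2^-1).
set t := sigma + _ * (m.+1%:R `^ (- 2^-1)) in IH.
have rho0 n : 0 <= rho n by exact: powR_ge0.
(* Strict positivity of [sigma] permits the division by [t] in [c1]. *)
have t0 : 0 < t.
  by rewrite /t ltr_pwDl// mulr_ge0 ?powR_ge0// addr_ge0 ?mulr_ge0.
(* [q] will bound the factor of [|e|]: [sigma] comes from Cauchy-Schwarz against [u - x], and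
   [c * rho m.+1] from the distance of [pim m] from [pi], where [rho m.+1] is [m + 2] to the power
   [-1/2]. *)
pose beta : R := m.+2%:R^-1; pose q := sigma + c * rho m.+1.
have b0 : 0 <= beta by rewrite invr_ge0.
have b1 : beta <= 1 by rewrite invf_le1// ler1n.
have q0 : 0 <= q by rewrite addr_ge0 ?mulr_ge0// ltW.
have al0 : 0 <= 1 - beta by rewrite subr_ge0.
(* [2 * |e| <= |e| ^+ 2 / t + t] turns the bound into one linear in [|e| ^+ 2]. *)
pose c1 := (1 - beta) ^+ 2 + (1 - beta) * beta * (q / t).
pose c2 := (1 - beta) * beta * (q * t) + beta ^+ 2 * K ^+ 2.
have ab0 : 0 <= (1 - beta) * beta by rewrite mulr_ge0.
have c10 : 0 <= c1.
  by rewrite addr_ge0 ?sqr_ge0// (mulr_ge0 ab0)// divr_ge0// ltW.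
have c20 : 0 <= c2.
  by rewrite addr_ge0// ?mulr_ge0 ?sqr_ge0// ltW.
have pw w : (\sum_(i <oo) (pim m i)%:E * (Phi (history P idx m w) i)%:E <=
   c1%:E * (form_norm a (u - v (history P idx m w)) ^+ 2)%:E + c2%:E)%E.
  set vh := v _; rewrite /Phi -/vh relaxationE.
  rewrite (le_trans (expected_step_bound a aW Rop T L a_ge0 a_def L_ge0 Rop_bound
    T_adj u vh beta H (D * rho m.+1) (pim m) pi I y _ H0 (pimP m) pi_gt0
    (pim_close m) yH))//; first by rewrite b0 b1.
  rewrite -EFinM -EFinD lee_fin -/K.
  set e := u - vh; have e0 := form_norm_ge0 a e.
  have eq1 : sre (a e (u - \sum_(i <- I) Rop i (y i))) +
      H * L * form_norm a e * (D * rho m.+1) <= form_norm a e * q.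
    rewrite /q mulrDr lerD//.
      by rewrite (le_trans (form_CS a a_ge0 _ _))// ler_wpM2l.
    by rewrite /c le_eqVlt; apply/orP; left; apply/eqP; ring.
  have amgm : 2 * form_norm a e <= form_norm a e ^+ 2 / t + t.
    rewrite -subr_ge0 (_ : _ - _ = (form_norm a e - t) ^+ 2 / t).
      by rewrite divr_ge0 ?sqr_ge0// ltW.
    by field; rewrite gt_eqF.
  have {}eq1 := ler_wpM2l ab0 eq1.
  have {}amgm := ler_wpM2l (mulr_ge0 ab0 q0) amgm.
  rewrite /c1 /c2; move: eq1 amgm.
  set E := _ + _ * (D * _); set N := form_norm a e.
  move=> eq1 amgm; nra.
apply: (@le_trans _ _ (\int[P]_w (c1%:E *
   (form_norm a (u - v (history P idx m w)) ^+ 2)%:E + c2%:E)%E)%E).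
  apply: ge0_le_integral => //.
  - move=> w _; apply: nneseries_ge0 => i _ _.
    by rewrite -EFinM lee_fin mulr_ge0 ?sqr_ge0.
  - apply: (measurable_comp_nat _
      (fun h => \sum_(i <oo) (pim m i)%:E * (Phi h i)%:E)%E).
    exact: mh.
  - apply: (measurable_comp_nat _
      (fun h => c1%:E * (form_norm a (u - v h) ^+ 2)%:E + c2%:E)%E).
    exact: mh.
have mf : measurable_fun setT (fun w =>
    (form_norm a (u - v (history P idx m w)) ^+ 2)%:E).
  by apply: (measurable_comp_nat _ (fun h => (form_norm a (u - v h) ^+ 2)%:E)).
rewrite ge0_integralD//; last 2 first.
- by move=> w _; rewrite -EFinM lee_fin mulr_ge0 ?sqr_ge0.
- by apply: emeasurable_funM => //; exact: measurable_cst.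
rewrite ge0_integralZl//; last by move=> w _; rewrite lee_fin sqr_ge0.
rewrite integral_cst//= probability_setT mule1.
apply: (@le_trans _ _ (c1%:E * (t ^+ 2)%:E + c2%:E)%E).
  by rewrite leeD2r// lee_wpmul2l// lee_fin.
(* The linearization is sharp at [|e| = t], so [c1 * t ^+ 2 + c2] is exactly the left side of
   [rate_step]. *)
rewrite -EFinM -EFinD lee_fin; apply: le_trans (rate_step m _ _ _ (ltW sigma0) c0 K0).
rewrite -[leRHS]/((1 - beta) ^+ 2 * t ^+ 2 + 2 * (1 - beta) * beta * (q * t)
                  + beta ^+ 2 * K ^+ 2) /c1 /c2 le_eqVlt; apply/orP; left.
by apply/eqP; field; rewrite gt_eqF.
Qed.

End MeanSquare.

(** * Passage from the span to the approximation space *)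

Theorem proposition1 (R : realType) :
  exists C : R -> R -> R -> R -> R,
  forall (k : scalar_kind)
    (V : completeNormedModType (scalarK R k)) (s : {dot V for sconj})
    (a : {hermitian_sym V for sconj})
    (F : V -> scalarK R k) (u : V)
    (W : nat -> completeNormedModType (scalarK R k))
    (aW : forall i, {dot (W i) for sconj})
    (Rop : forall i, {linear W i -> V})
    (T : forall i, V -> W i)
    (Lambda : R) (pi : nat -> R) (pim : nat -> nat -> R) (D : R)
    (A : completeNormedModType (scalarK R k)) (j : V -> A) (iota : A -> V)
    (d : measure_display) (Omega : measurableType d) (P : probability Omega R)
    (idx : nat -> {RV P >-> nat}),
  induces_norm s ->
  separable_space V ->
  continuous_form a ->
  coercive_form a ->
  conj_linear F ->
  bounded_functional F ->
  (forall v : V, a u v = F v) ->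
  (forall i, induces_norm (aW i)) ->
  form_dense a (splitting_span Rop) ->
  (forall i (w : W i), form_norm a (Rop i w) <= Lambda * form_norm (aW i) w) ->
  (forall i (v : V) (w : W i), aW i (T i v) w = a v (Rop i w)) ->
  discrete_distribution pi ->
  (forall i, 0 < pi i) ->
  (forall m, discrete_distribution (pim m)) ->
  0 < D ->
  (forall m, (l1_norm (fun i => (pim m i - pi i)%R)
              <= (D * m.+2%:R `^ (- 2^-1))%:E)%E) ->
  mutually_independent P (fun m => idx m) ->
  (forall m i, P (idx m @^-1` [set i]) = (pim m i)%:E) ->
  is_completion (splitting_span Rop) (approx_norm aW Rop pi) j ->
  extends_inclusion (splitting_span Rop) j iota ->
  forall (h : A) (m : nat),
    (poweR 'E_P[fun w => (form_norm a (u - schwarz_iterate a Rop T u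
                           (fun n => idx n w) m) ^+ 2)%R] 2^-1
     <= (2 * form_norm a (u - iota h)
         + C Lambda (form_norm a u) (rnorm h) D
           * m.+1%:R `^ (- 2^-1))%:E)%E.
Proof.
(* With [H = nh + 1] and [L = |Lambda|] this is the constant of [mean_square_bound]; the absolute
   value makes the operator bound nonnegative. *)
exists (fun Lambda nu nh D => 2 * ((nh + 1) * `|Lambda| * D)
                              + 2 * (nu + `|Lambda| * (nh + 1))).
move=> k V s a F u W aW Rop T Lambda pi pim D A j iota d Omega P idx.
move=> _ _ acont [c c0 acoer] _ _ _ _ _ RopL T_adj _ pi0 pimP D0 pim_close.
move=> idx_indep idx_law jcompl iota_ext h m.
have a_ge0 v : 0 <= sre (a v v).
  by rewrite (le_trans _ (acoer v))// mulr_ge0 ?sqr_ge0// ltW.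
have a_def v : form_norm a v = 0 -> v = 0.
  move=> av0; apply/eqP; apply: contraT => /rnorm_gt0 v0.
  have := acoer v; rewrite -form_norm_sq// av0 expr0n/= leNgt.
  by rewrite mulr_gt0// exprn_gt0.
have RopL' i w : form_norm a (Rop i w) <= `|Lambda| * form_norm (aW i) w.
  rewrite (le_trans (RopL i w))// ler_wpM2r ?ler_norm//.
  exact: form_norm_ge0.
have H0 : 0 <= rnorm h + 1 by rewrite addr_ge0 ?rnorm_ge0.
set rate := powR _ _; set C := (X in X * rate).
have sigma0 := form_norm_ge0 a (u - iota h).
(* The bound is proved with [form_norm a (u - iota h)] counted once; doubling it only enlarges the
   right side. *)
apply: (@le_trans _ _ (form_norm a (u - iota h) + C * rate)%:E); last first.
  by rewrite lee_fin lerD2r; move: sigma0; lra.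
(* Density gives the span element only up to [eps]; adding [eps] also keeps [sigma] positive when
   [u = iota h]. *)
apply/lee_addgt0Pr => eps eps0.
have [I [y [yH yeps]]] :=
  span_approximation a aW Rop pi A j iota h eps acont pi0 jcompl iota_ext eps0.
have ux : form_norm a (u - \sum_(i <- I) Rop i (y i)) <=
          form_norm a (u - iota h) + eps.
  rewrite -(subrKA (iota h)) (le_trans (form_norm_triangle a a_ge0 _ _))//.
  by rewrite lerD2l.
have sigma_gt0 : 0 < form_norm a (u - iota h) + eps by rewrite ltr_wpDl.
have := mean_square_bound a aW Rop T `|Lambda| a_ge0 a_def (normr_ge0 _) RopL'
  T_adj P idx pi pim D pi0 pimP (ltW D0) pim_close idx_indep idx_law u I y
  (rnorm h + 1) _ m H0 sigma_gt0 yH ux.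
rewrite -/C -/rate unlock => msb.
have rate0 : 0 <= rate by exact: powR_ge0.
have C0 : 0 <= C.
  by rewrite addr_ge0 ?mulr_ge0// ?addr_ge0 ?mulr_ge0 ?form_norm_ge0// ltW.
have int0 : (0 <= \int[P]_w (form_norm a (u - schwarz_iterate a Rop T u
                                 (fun n => idx n w) m) ^+ 2)%:E)%E.
  by apply: integral_ge0 => w _; rewrite lee_fin sqr_ge0.
apply: le_trans (gt0_ler_poweR _ _ _ msb) _ => //.
- by rewrite in_itv/= int0 leey.
- by rewrite in_itv/= lee_fin sqr_ge0 leey.
rewrite poweR_EFin powR12_sqrt ?sqr_ge0// sqrtr_sqr ger0_norm.
  by rewrite -EFinD lee_fin addrAC.
by rewrite addr_ge0 ?mulr_ge0// ltW.
Qed.
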